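(* For every integer $n \geq 97$ there exists a 4-regular matchstick graph with exactly $n$ vertices.
   Context: A matchstick graph is a finite graph drawn in the Euclidean plane such that vertices are distinct points, every edge is a straight line segment of length 1 between its endpoints, and edges do not cross or overlap (two edges intersect at most in a common endpoint). A matchstick graph is 4-regular if every vertex has degree exactly 4. *)

(* Defs.v *)
From Stdlib Require Import Reals List Arith.
Import ListNotations.
Open Scope R_scope.

Definition point := (R * R)%type.

Definition dist2 (P Q : point) : R :=
  (fst P - fst Q) ^ 2 + (snd P - snd Q) ^ 2.

Definition on_segment (P Q X : point) : Prop :=
  exists t : R, 0 <= t <= 1 /\
    X = ((1 - t) * fst P + t * fst Q, (1 - t) * snd P + t * snd Q).

Record simple_graph (n : nat) (adj : nat -> nat -> bool) : Prop := {
  sg_irrefl : forall i, adj i i = false;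
  sg_sym : forall i j, adj i j = adj j i;
  sg_support : forall i j, adj i j = true -> (i < n)%nat /\ (j < n)%nat
}.

Definition degree (n : nat) (adj : nat -> nat -> bool) (i : nat) : nat :=
  length (filter (fun j => adj i j) (seq 0 n)).

Definition matchstick_drawing (n : nat) (adj : nat -> nat -> bool)
    (pos : nat -> point) : Prop :=
  (forall i j, (i < n)%nat -> (j < n)%nat -> pos i = pos j -> i = j) /\
  (forall i j, adj i j = true -> dist2 (pos i) (pos j) = 1) /\
  (forall a b c d, adj a b = true -> adj c d = true ->
     ~ ((a = c /\ b = d) \/ (a = d /\ b = c)) ->
     forall X, on_segment (pos a) (pos b) X -> on_segment (pos c) (pos d) X ->
       (X = pos a \/ X = pos b) /\ (X = pos c \/ X = pos d)).

Definition four_regular_matchstick_graph (n : nat) : Prop :=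
  exists (adj : nat -> nat -> bool) (pos : nat -> point),
    simple_graph n adj /\
    (forall i, (i < n)%nat -> degree n adj i = 4%nat) /\
    matchstick_drawing n adj pos.

(* Main.v *)
(* Connectedness is not required, so disjoint unions are allowed; with one graph on 60 vertices
   it suffices to draw the orders 97, ..., 156. All drawings have their vertices in Z[zeta_12]
   and their edges in the 12 directions of the roots of unity. The basic one is a ring of 12
   trapezoids, each made of three triangles, around a regular 12-gon of side 1. Cutting the
   ring along a leg and inserting a translation of 6 vertices, and the same one on the opposite
   side, adds 12 vertices; other pieces, found by computer search, supply a starting ring for
   each residue mod 12. Two edges in these directions that share no point are separated by the
   projection onto one of six axes, so planarity is decided by integer comparisons. *)
Require Import Defs.
From Stdlib Require Import Reals List Arith.
From Stdlib Require Import ZArith Lra Lia Psatz Permutation.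
Import ListNotations.

Local Open Scope R_scope.

(** * Points of Z[zeta_12] in the plane *)

(* [Pt a b c d] is a + b zeta + c zeta^2 + d zeta^3 with zeta = exp(i pi/6), so zeta^4 = zeta^2 - 1. *)
Record pt := Pt { c0 : Z; c1 : Z; c2 : Z; c3 : Z }.

(** Nested [if]s stop at the first difference; with [&&], the call-by-value [vm_compute] would
    evaluate all four comparisons. *)
Definition eqb (p q : pt) : bool :=
  (if c0 p =? c0 q then if c1 p =? c1 q then if c2 p =? c2 q then c3 p =? c3 q
   else false else false else false)%Z.

Lemma eqb_eq (p q : pt) : eqb p q = true <-> p = q.
Proof.
  destruct p as [a b c d], q as [a' b' c' d']; unfold eqb; simpl; split.
  - destruct (Z.eqb_spec a a'), (Z.eqb_spec b b'), (Z.eqb_spec c c'); try discriminate.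
    intros E%Z.eqb_eq; congruence.
  - intros E; injection E as -> -> -> ->; now rewrite !Z.eqb_refl.
Qed.

Lemma eqb_neq (p q : pt) : eqb p q = false <-> p <> q.
Proof. rewrite <- eqb_eq; destruct (eqb p q); split; congruence. Qed.

Definition pt_eq_dec (p q : pt) : {p = q} + {p <> q} :=
  (if eqb p q as b return eqb p q = b -> {p = q} + {p <> q}
   then fun E => left (proj1 (eqb_eq p q) E)
   else fun E => right (proj1 (eqb_neq p q) E)) eq_refl.

Definition add (p q : pt) : pt :=
  (Pt (c0 p + c0 q) (c1 p + c1 q) (c2 p + c2 q) (c3 p + c3 q))%Z.

Definition sub (p q : pt) : pt :=
  (Pt (c0 p - c0 q) (c1 p - c1 q) (c2 p - c2 q) (c3 p - c3 q))%Z.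

(** Multiplication by zeta, reduced with zeta^4 = zeta^2 - 1. *)
Definition rot (p : pt) : pt := Pt (- c3 p) (c0 p) (c1 p + c3 p) (c2 p).

Definition dir (k : nat) : pt := Nat.iter k rot (Pt 1 0 0 0).

Definition emb (p : pt) : point :=
  (IZR (c0 p) + IZR (c2 p) / 2 + IZR (c1 p) * (sqrt 3 / 2),
   IZR (c1 p) / 2 + IZR (c3 p) + IZR (c2 p) * (sqrt 3 / 2)).

Lemma sqrt3_sqr : sqrt 3 * sqrt 3 = 3.
Proof. apply sqrt_sqrt; lra. Qed.

(** 1351/780 is a convergent of sqrt 3, as 1351^2 - 3 * 780^2 = 1; the lower bound is 1351/780 -
    4/7800000. *)
Lemma sqrt3_bounds : 13509996 / 7800000 < sqrt 3 < 1351 / 780.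
Proof.
  pose proof sqrt3_sqr. pose proof (sqrt_pos 3). split; nra.
Qed.

(** Infinite descent, with [m] bounding |b|: 3 divides a = 3a', and (b, a') is a smaller
    solution. *)
Lemma sqr_eq_3sqr (m : nat) (a b : Z) :
  (Z.abs b <= Z.of_nat m)%Z -> (a * a = 3 * (b * b))%Z -> b = 0%Z.
Proof.
  revert a b; induction m as [|m IH]; intros a b Hb E; [lia|].
  assert (Ha : (a mod 3 = 0)%Z).
  { assert (H : ((a * a) mod 3 = 0)%Z) by (rewrite E, Z.mul_comm; apply Z.mod_mul; lia).
    rewrite Z.mul_mod in H by lia.
    assert (H0 : (a mod 3 = 0 \/ a mod 3 = 1 \/ a mod 3 = 2)%Z)
      by (pose proof (Z.mod_pos_bound a 3); lia).
    destruct H0 as [R|[R|R]]; rewrite R in H; [assumption|discriminate H|discriminate H]. }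
  apply Z.mod_divide in Ha; [|lia]. destruct Ha as [a' ->].
  assert (E' : (b * b = 3 * (a' * a'))%Z) by lia.
  destruct (Z.eq_dec b 0) as [|Hb0]; [assumption|].
  assert (a' = 0)%Z by (apply (IH b); [nia|assumption]).
  nia.
Qed.

Lemma sqrt3_irrational (a b : Z) : IZR a + IZR b * sqrt 3 = 0 -> a = 0%Z /\ b = 0%Z.
Proof.
  intros H.
  assert (E : (a * a = 3 * (b * b))%Z).
  { apply eq_IZR. rewrite !mult_IZR.
    replace (IZR a) with (- IZR b * sqrt 3) by lra.
    pose proof sqrt3_sqr. nra. }
  assert (b = 0)%Z by (apply (sqr_eq_3sqr (Z.abs_nat b) a); [lia|assumption]).
  split; [nia|assumption].
Qed.

(** Twice the coordinates are (2a + c) + b sqrt 3 and (b + 2d) + c sqrt 3, so irrationality of sqrt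
    3 recovers all four coefficients. *)
Lemma emb_inj (p q : pt) : emb p = emb q -> p = q.
Proof.
  destruct p as [a b c d], q as [a' b' c' d']; unfold emb; simpl; intros H.
  injection H as Hx Hy.
  destruct (sqrt3_irrational (2 * (a - a') + (c - c')) (b - b')) as [H1 H2].
  { rewrite plus_IZR, mult_IZR, !minus_IZR. lra. }
  destruct (sqrt3_irrational ((b - b') + 2 * (d - d')) (c - c')) as [H3 H4].
  { rewrite plus_IZR, mult_IZR, !minus_IZR. lra. }
  f_equal; lia.
Qed.

(** The squared modulus is (a^2 + b^2 + c^2 + d^2 + ac + bd) + (ab + bc + cd) sqrt 3. *)
Definition unit_vec (p : pt) : bool :=
  let '(Pt a b c d) := p in
  ((a * a + b * b + c * c + d * d + a * c + b * d =? 1)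
   && (a * b + b * c + c * d =? 0))%Z%bool.

Lemma unit_vec_dist2 (p q : pt) : unit_vec (sub q p) = true -> dist2 (emb p) (emb q) = 1.
Proof.
  destruct p as [a b c d], q as [a' b' c' d']; unfold unit_vec, sub, dist2, emb; simpl.
  rewrite Bool.andb_true_iff, !Z.eqb_eq; intros [H1 H2].
  apply (f_equal IZR) in H1, H2.
  repeat rewrite ?plus_IZR, ?mult_IZR, ?minus_IZR in H1.
  repeat rewrite ?plus_IZR, ?mult_IZR, ?minus_IZR in H2.
  pose proof sqrt3_sqr as H3.
  set (A := IZR a' - IZR a) in *. set (B := IZR b' - IZR b) in *.
  set (C := IZR c' - IZR c) in *. set (D := IZR d' - IZR d) in *.
  replace (_ + _) with
    (A ^ 2 + A * C + C ^ 2 / 4 + B ^ 2 / 4 + B * D + D ^ 2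
     + (A * B + B * C + C * D) * sqrt 3
     + (B ^ 2 + C ^ 2) / 4 * (sqrt 3 * sqrt 3)) by (unfold A, B, C, D; field).
  rewrite H2, H3. lra.
Qed.

(** * Segments separated by one of six axes *)

Definition rotR (X : point) : point :=
  (fst X * (sqrt 3 / 2) - snd X / 2, fst X / 2 + snd X * (sqrt 3 / 2)).

Lemma emb_rot (p : pt) : emb (rot p) = rotR (emb p).
Proof.
  destruct p as [a b c d]; unfold emb, rot, rotR; simpl.
  rewrite opp_IZR, plus_IZR. pose proof sqrt3_sqr as H.
  f_equal.
  - transitivity ((IZR b * (sqrt 3 * sqrt 3) - IZR b) / 4 - IZR d / 2 + IZR a * (sqrt 3 / 2));
      [rewrite H|]; field.
  - transitivity (IZR a / 2 + IZR c / 4 + IZR c * (sqrt 3 * sqrt 3) / 4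
                  + (IZR b + IZR d) * (sqrt 3 / 2)); [rewrite H|]; field.
Qed.

Lemma on_segment_rotR (P Q X : point) :
  on_segment P Q X -> on_segment (rotR P) (rotR Q) (rotR X).
Proof.
  intros [t [Ht ->]]; exists t; split; [assumption|].
  unfold rotR; simpl; f_equal; field.
Qed.

Lemma on_segment_rot_iter (k : nat) (p q : pt) (X : point) :
  on_segment (emb p) (emb q) X ->
  on_segment (emb (Nat.iter k rot p)) (emb (Nat.iter k rot q)) (Nat.iter k rotR X).
Proof.
  intros H; induction k as [|k IH]; simpl; [assumption|].
  rewrite !emb_rot. now apply on_segment_rotR.
Qed.

Lemma convex_between (a b l u t : R) :
  0 <= t <= 1 -> l < a < u -> l < b < u -> l < (1 - t) * a + t * b < u.
Proof. intros; destruct (Rle_dec a b); split; nra. Qed.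

(* [key k p] approximates 1560 times the first coordinate of zeta^k p, using 1351/780 for sqrt 3. *)
Definition key (k : nat) (p : pt) : Z :=
  let q := Nat.iter k rot p in (780 * (2 * c0 q + c2 q) + 1351 * c1 q)%Z.

Definition small (p : pt) : bool :=
  forallb (fun k => Z.abs (c1 (Nat.iter k rot p)) <=? 1000)%Z (seq 0 6).

(** The error is |c1| |780 sqrt 3 - 1351|, at most 1000 * 780 * 4/7800000 = 0.4 by [small] and
    [sqrt3_bounds]. *)
Lemma key_approx (k : nat) (p : pt) :
  (k < 6)%nat -> small p = true ->
  Rabs (1560 * fst (emb (Nat.iter k rot p)) - IZR (key k p)) < 1 / 2.
Proof.
  intros Hk Hs. unfold small in Hs. rewrite forallb_forall in Hs.
  specialize (Hs k). rewrite in_seq, Z.leb_le in Hs. specialize (Hs ltac:(lia)).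
  unfold key. destruct (Nat.iter k rot p) as [a b c d].
  cbn [emb fst c0 c1 c2] in *.
  assert (Hb : -1000 <= IZR b <= 1000) by (split; apply IZR_le; lia).
  rewrite plus_IZR, !mult_IZR, plus_IZR, mult_IZR.
  pose proof sqrt3_bounds. apply Rabs_def1; nra.
Qed.

Definition edge : Type := pt * pt.

(** The shadows of the edge on six axes 30 degrees apart, in approximate integer coordinates. *)
Definition profile (e : edge) : list (Z * Z) :=
  map (fun k => let x := key k (fst e) in let y := key k (snd e) in
         (Z.min x y, Z.max x y)) (seq 0 6).

Fixpoint separated (l m : list (Z * Z)) : bool :=
  match l, m with
  | (a, b) :: l', (c, d) :: m' =>
      if (b <? c)%Z then true else if (d <? a)%Z then true else separated l' m'
  | _, _ => false
  end.

Lemma separated_nth (e f : edge) (ks : list nat) :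
  separated (map (fun k => let x := key k (fst e) in let y := key k (snd e) in
                     (Z.min x y, Z.max x y)) ks)
            (map (fun k => let x := key k (fst f) in let y := key k (snd f) in
                     (Z.min x y, Z.max x y)) ks) = true ->
  exists k, In k ks /\
    ((Z.max (key k (fst e)) (key k (snd e)) < Z.min (key k (fst f)) (key k (snd f)))%Z \/
     (Z.max (key k (fst f)) (key k (snd f)) < Z.min (key k (fst e)) (key k (snd e)))%Z).
Proof.
  induction ks as [|k ks IH]; simpl; [discriminate|].
  destruct (Z.ltb_spec (Z.max (key k (fst e)) (key k (snd e)))
                       (Z.min (key k (fst f)) (key k (snd f)))); [exists k; tauto|].
  destruct (Z.ltb_spec (Z.max (key k (fst f)) (key k (snd f)))
                       (Z.min (key k (fst e)) (key k (snd e)))); [exists k; tauto|].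
  intros H1. destruct (IH H1) as [j Hj]; exists j; tauto.
Qed.

Definition small_edge (e : edge) : bool := (small (fst e) && small (snd e))%bool.

Lemma key_bounds_on_edge (k : nat) (e : edge) (X : point) :
  (k < 6)%nat -> small_edge e = true -> on_segment (emb (fst e)) (emb (snd e)) X ->
  IZR (Z.min (key k (fst e)) (key k (snd e))) - 1 / 2 < 1560 * fst (Nat.iter k rotR X) /\
  1560 * fst (Nat.iter k rotR X) < IZR (Z.max (key k (fst e)) (key k (snd e))) + 1 / 2.
Proof.
  destruct e as [p q]; unfold small_edge; cbn [fst snd]; rewrite Bool.andb_true_iff.
  intros Hk [Hp Hq] HX.
  apply (on_segment_rot_iter k) in HX.
  pose proof (key_approx k p Hk Hp) as Ap. pose proof (key_approx k q Hk Hq) as Aq.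
  apply Rabs_def2 in Ap, Aq.
  destruct HX as [t [Ht HX]]. rewrite HX; cbn [fst].
  set (x := fst (emb (Nat.iter k rot p))) in *.
  set (y := fst (emb (Nat.iter k rot q))) in *.
  pose proof (IZR_le _ _ (Z.le_min_l (key k p) (key k q))).
  pose proof (IZR_le _ _ (Z.le_min_r (key k p) (key k q))).
  pose proof (IZR_le _ _ (Z.le_max_l (key k p) (key k q))).
  pose proof (IZR_le _ _ (Z.le_max_r (key k p) (key k q))).
  replace (1560 * ((1 - t) * x + t * y)) with ((1 - t) * (1560 * x) + t * (1560 * y)) by ring.
  apply convex_between; [assumption| |]; lra.
Qed.

Definition meet_at_ends (P Q P' Q' : point) : Prop :=
  forall X, on_segment P Q X -> on_segment P' Q' X -> (X = P \/ X = Q) /\ (X = P' \/ X = Q').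

(** Integer intervals that are strictly apart have a gap of at least 1, which exceeds the two
    rounding errors, each below 1/2. The edges are therefore disjoint. *)
Lemma separated_meet (e f : edge) :
  small_edge e = true -> small_edge f = true -> separated (profile e) (profile f) = true ->
  meet_at_ends (emb (fst e)) (emb (snd e)) (emb (fst f)) (emb (snd f)).
Proof.
  intros He Hf H X HX HX'. exfalso.
  destruct (separated_nth e f _ H) as [k [Hk Hs]]. apply in_seq in Hk.
  destruct (key_bounds_on_edge k e X ltac:(lia) He HX).
  destruct (key_bounds_on_edge k f X ltac:(lia) Hf HX').
  destruct Hs as [Hs|Hs]; apply Zlt_le_succ, IZR_le in Hs; rewrite succ_IZR in Hs; lra.
Qed.

Lemma on_segment_sym (P Q X : point) : on_segment P Q X -> on_segment Q P X.
Proof.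
  intros [t [Ht ->]]; exists (1 - t); split; [lra|]. f_equal; ring.
Qed.

Lemma meet_at_ends_flip_l (P Q P' Q' : point) :
  meet_at_ends P Q P' Q' -> meet_at_ends Q P P' Q'.
Proof. intros H X H1 H2; apply on_segment_sym in H1; specialize (H X H1 H2); tauto. Qed.

Lemma meet_at_ends_sym (P Q P' Q' : point) :
  meet_at_ends P Q P' Q' -> meet_at_ends P' Q' P Q.
Proof. intros H X H1 H2; specialize (H X H2 H1); tauto. Qed.

Lemma meet_at_ends_flip_r (P Q P' Q' : point) :
  meet_at_ends P Q P' Q' -> meet_at_ends P Q Q' P'.
Proof. intros H; now apply meet_at_ends_sym, meet_at_ends_flip_l, meet_at_ends_sym. Qed.

(** A common point is O + t u = O + s v with u, v unit vectors. Comparing lengths gives t = s, and t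
    <> 0 would force u = v. *)
Lemma unit_fork_meet (O P Q : point) :
  dist2 O P = 1 -> dist2 O Q = 1 -> P <> Q -> meet_at_ends O P O Q.
Proof.
  destruct O as [o o'], P as [p p'], Q as [q q']; unfold dist2; simpl.
  intros HP HQ Hne X [t [Ht ->]] [s [Hs E]]; simpl in *.
  injection E as E1 E2.
  set (u := p - o) in *. set (u' := p' - o') in *.
  set (v := q - o) in *. set (v' := q' - o') in *.
  assert (F1 : t * u = s * v) by (unfold u, v; lra).
  assert (F2 : t * u' = s * v') by (unfold u', v'; lra).
  assert (G1 : u * u + u' * u' = 1) by (unfold u, u'; lra).
  assert (G2 : v * v + v' * v' = 1) by (unfold v, v'; lra).
  assert (T : t * t = s * s).
  { transitivity (t * u * (t * u) + t * u' * (t * u')).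
    - replace (_ + _) with (t * t * (u * u + u' * u')) by ring. rewrite G1; ring.
    - rewrite F1, F2. replace (_ + _) with (s * s * (v * v + v' * v')) by ring. rewrite G2; ring. }
  assert (t = s) by nra. subst s.
  destruct (Req_dec t 0) as [->|Ht0].
  - split; left; f_equal; ring.
  - exfalso; apply Hne.
    apply Rmult_eq_reg_l in F1; [|assumption]. apply Rmult_eq_reg_l in F2; [|assumption].
    unfold u, u', v, v' in *; f_equal; lra.
Qed.

(** * A decision procedure for drawings on Z[zeta_12] *)

Definition fork (e f : edge) : bool :=
  let '(a, b) := e in let '(c, d) := f in
  (eqb a c && negb (eqb b d) || eqb a d && negb (eqb b c)
   || eqb b c && negb (eqb a d) || eqb b d && negb (eqb a c))%bool.

Lemma dist2_sym (P Q : point) : dist2 P Q = dist2 Q P.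
Proof. unfold dist2; ring. Qed.

Lemma fork_meet (e f : edge) :
  dist2 (emb (fst e)) (emb (snd e)) = 1 -> dist2 (emb (fst f)) (emb (snd f)) = 1 ->
  fork e f = true ->
  meet_at_ends (emb (fst e)) (emb (snd e)) (emb (fst f)) (emb (snd f)).
Proof.
  destruct e as [a b], f as [c d]; simpl; intros He Hf.
  rewrite !Bool.orb_true_iff, !Bool.andb_true_iff, !Bool.negb_true_iff, !eqb_eq, !eqb_neq.
  pose proof He as He'; pose proof Hf as Hf'. rewrite dist2_sym in He', Hf'.
  intros [[[[-> H]|[-> H]]|[-> H]]|[-> H]].
  - apply unit_fork_meet; auto using emb_inj.
  - apply meet_at_ends_flip_r, unit_fork_meet; auto using emb_inj.
  - apply meet_at_ends_flip_l, unit_fork_meet; auto using emb_inj.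
  - apply meet_at_ends_flip_l, meet_at_ends_flip_r, unit_fork_meet; auto using emb_inj.
Qed.

(** First endpoints suffice for closed walks; [check] tests that every second endpoint is among
    them. *)
Definition verts (es : list edge) : list pt := nodup pt_eq_dec (map fst es).

Definition nbrs (es : list edge) (p : pt) : list pt :=
  nodup pt_eq_dec (flat_map (fun e =>
    if pt_eq_dec (fst e) p then [snd e] else if pt_eq_dec (snd e) p then [fst e] else []) es).

(** An edge listed twice, in either orientation, passes neither test, so accepted lists have no
    repetitions. *)
Definition compatible (x y : edge * list (Z * Z)) : bool :=
  if separated (snd x) (snd y) then true else fork (fst x) (fst y).

Fixpoint all_pairs {A : Type} (f : A -> A -> bool) (l : list A) : bool :=
  match l with
  | [] => true
  | x :: l' => (forallb (f x) l' && all_pairs f l')%bool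
  end.

Definition check (n : nat) (es : list edge) : bool :=
  let vs := verts es in
  ((length vs =? n)%nat
   && forallb (fun e => if in_dec pt_eq_dec (snd e) vs then true else false) es
   && forallb (fun p => length (nbrs es p) =? 4)%nat vs
   && forallb small_edge es
   && forallb (fun e => unit_vec (sub (snd e) (fst e))) es
   && all_pairs compatible (map (fun e => (e, profile e)) es))%bool.

(** * Soundness of the decision procedure *)

Lemma all_pairs_In {A B : Type} (f : B -> B -> bool) (g : A -> B) (l : list A) (x y : A) :
  all_pairs f (map g l) = true -> In x l -> In y l ->
  x = y \/ f (g x) (g y) = true \/ f (g y) (g x) = true.
Proof.
  induction l as [|z l IH]; simpl; [tauto|].
  rewrite Bool.andb_true_iff, forallb_forall. intros [H1 H2].
  intros [->|Hx] [->|Hy]; auto using in_map.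
Qed.

Lemma in_nbrs (es : list edge) (p q : pt) :
  In q (nbrs es p) -> In (p, q) es \/ In (q, p) es.
Proof.
  unfold nbrs; rewrite nodup_In, in_flat_map. intros [[a b] [Hin H]]; simpl in H.
  destruct (pt_eq_dec a p) as [->|]; [destruct H as [<-|[]]; auto|].
  destruct (pt_eq_dec b p) as [->|]; [destruct H as [<-|[]]; auto|destruct H].
Qed.

Lemma nbrs_in (es : list edge) (p q : pt) :
  In (p, q) es \/ In (q, p) es -> p <> q -> In q (nbrs es p).
Proof.
  intros H Hne; unfold nbrs; rewrite nodup_In, in_flat_map.
  destruct H as [H|H]; [exists (p, q)|exists (q, p)]; split; auto; simpl.
  - destruct (pt_eq_dec p p); simpl; tauto.
  - destruct (pt_eq_dec q p); [congruence|]. destruct (pt_eq_dec p p); simpl; tauto.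
Qed.

Lemma length_filter_mem (vs l : list pt) :
  NoDup vs -> NoDup l -> incl l vs ->
  length (filter (fun p => if in_dec pt_eq_dec p l then true else false) vs) = length l.
Proof.
  intros Hv Hl Hi. apply Permutation_length, NoDup_Permutation; auto using NoDup_filter.
  intros x; rewrite filter_In. destruct (in_dec pt_eq_dec x l) as [H|H]; split.
  - tauto.
  - auto.
  - intros [_ F]; discriminate F.
  - tauto.
Qed.

Lemma length_filter_nth {A : Type} (d : A) (f : A -> bool) (l : list A) :
  length (filter (fun j => f (nth j l d)) (seq 0 (length l))) = length (filter f l).
Proof.
  induction l as [|x l IH]; simpl; [reflexivity|].
  rewrite <- seq_shift.
  assert (E : forall m, length (filter (fun j => f (nth j (x :: l) d)) (map S m))
                        = length (filter (fun j => f (nth j l d)) m)).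
  { induction m as [|j m IHm]; simpl; [reflexivity|].
    destruct (f (nth j l d)); simpl; rewrite <- IHm; reflexivity. }
  simpl in E. destruct (f x); simpl; rewrite E, IH; reflexivity.
Qed.

Lemma check_sound (n : nat) (es : list edge) :
  check n es = true -> four_regular_matchstick_graph n.
Proof.
  unfold check; rewrite !Bool.andb_true_iff, !forallb_forall, Nat.eqb_eq.
  set (vs := verts es). intros [[[[[Hn Hends] Hdeg] Hsmall] Hunit] Hpairs].
  assert (Hnd : NoDup vs) by apply NoDup_nodup.
  assert (Hfst : forall e, In e es -> In (fst e) vs).
  { intros e He; apply nodup_In; now apply in_map. }
  assert (Hsnd : forall e, In e es -> In (snd e) vs).
  { intros e He; specialize (Hends e He).
    destruct (in_dec pt_eq_dec (snd e) vs); [assumption|discriminate]. }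
  assert (Hlen : forall p q, In (p, q) es -> dist2 (emb p) (emb q) = 1).
  { intros p q H; apply unit_vec_dist2; exact (Hunit (p, q) H). }
  assert (Hloop : forall p, ~ In (p, p) es).
  { intros p H; apply Hlen in H; unfold dist2 in H; lra. }
  set (v := fun i => nth i vs (Pt 0 0 0 0)).
  assert (Hv : forall i, (i < n)%nat -> In (v i) vs).
  { intros i Hi; apply nth_In; lia. }
  assert (Hinj : forall i j, (i < n)%nat -> (j < n)%nat -> v i = v j -> i = j).
  { intros i j Hi Hj; apply NoDup_nth; auto; lia. }
  (* The range tests matter: beyond the list, [v] takes the default value 0, which may itself be a
     vertex. *)
  set (adj := fun i j => ((i <? n) && (j <? n) &&
    (if in_dec pt_eq_dec (v j) (nbrs es (v i)) then true else false))%nat%bool).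
  assert (Hadj : forall i j, adj i j = true ->
    (i < n)%nat /\ (j < n)%nat /\ (In (v i, v j) es \/ In (v j, v i) es)).
  { intros i j; unfold adj; rewrite !Bool.andb_true_iff, !Nat.ltb_lt.
    destruct (in_dec pt_eq_dec (v j) (nbrs es (v i))) as [H|];
      [|intros [_ F]; discriminate F].
    apply in_nbrs in H; tauto. }
  assert (Hsym : forall i j, adj i j = true -> adj j i = true).
  { intros i j H; destruct (Hadj i j H) as [Hi [Hj He]]; unfold adj.
    rewrite !Bool.andb_true_iff, !Nat.ltb_lt; split; [tauto|].
    destruct (in_dec pt_eq_dec (v i) (nbrs es (v j))) as [|F]; [reflexivity|].
    exfalso; apply F, nbrs_in; [tauto|]. intros E; rewrite E in He.
    destruct He as [He|He]; exact (Hloop _ He). }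
  exists adj, (fun i => emb (v i)). split; [|split; [|split; [|split]]].
  - split.
    + intros i; destruct (adj i i) eqn:E; [|reflexivity].
      destruct (Hadj i i E) as [_ [_ [H|H]]]; destruct (Hloop _ H).
    + intros i j; apply Bool.eq_true_iff_eq; split; apply Hsym.
    + intros i j H; apply Hadj in H; tauto.
  - intros i Hi; unfold degree.
    (* The count of indices j becomes a count of vertices [v j], then the length of the neighbour
       list that [check] has tested. *)
    rewrite <- (proj1 (Nat.eqb_eq _ _) (Hdeg (v i) (Hv i Hi))).
    rewrite <- (length_filter_mem vs (nbrs es (v i)) Hnd (NoDup_nodup _ _)).
    + rewrite <- (length_filter_nth (Pt 0 0 0 0)), Hn.
      f_equal; apply filter_ext_in; intros j Hj; apply in_seq in Hj; unfold adj.
      rewrite (proj2 (Nat.ltb_lt i n)), (proj2 (Nat.ltb_lt j n)) by lia. reflexivity.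
    + intros q Hq; apply in_nbrs in Hq; destruct Hq as [H|H];
        [apply (Hsnd _ H)|apply (Hfst _ H)].
  - intros i j Hi Hj E; apply Hinj; auto using emb_inj.
  - intros i j H; destruct (Hadj i j H) as [_ [_ [He|He]]]; [auto|].
    rewrite dist2_sym; auto.
  - assert (Hmeet : forall e f, In e es -> In f es -> e <> f ->
      meet_at_ends (emb (fst e)) (emb (snd e)) (emb (fst f)) (emb (snd f))).
    { assert (Hc : forall e f, In e es -> In f es ->
        compatible (e, profile e) (f, profile f) = true ->
        meet_at_ends (emb (fst e)) (emb (snd e)) (emb (fst f)) (emb (snd f))).
      { intros e f He Hf; unfold compatible; cbn [fst snd].
        destruct (separated (profile e) (profile f)) eqn:H; intros H'.
        - apply separated_meet; auto.
        - destruct e, f; apply fork_meet; simpl; auto. }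
      intros e f He Hf Hne.
      destruct (all_pairs_In _ _ _ e f Hpairs He Hf) as [H|[H|H]]; [contradiction|auto|].
      apply meet_at_ends_sym; auto. }
    intros a b c d Hab Hcd Hne.
    destruct (Hadj a b Hab) as [Ha [Hb He]]. destruct (Hadj c d Hcd) as [Hc [Hd Hf]].
    change (meet_at_ends (emb (v a)) (emb (v b)) (emb (v c)) (emb (v d))).
    assert (N1 : (v a, v b) <> (v c, v d)).
    { intros E; injection E as E1 E2; apply Hne; left; auto. }
    assert (N2 : (v a, v b) <> (v d, v c)).
    { intros E; injection E as E1 E2; apply Hne; right; auto. }
    assert (N3 : (v b, v a) <> (v c, v d)) by congruence.
    assert (N4 : (v b, v a) <> (v d, v c)) by congruence.
    (* Each edge may be listed in either orientation, hence four cases. *)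
    destruct He as [He|He]; destruct Hf as [Hf|Hf].
    + exact (Hmeet _ _ He Hf N1).
    + apply meet_at_ends_flip_r; exact (Hmeet _ _ He Hf N2).
    + apply meet_at_ends_flip_l; exact (Hmeet _ _ He Hf N3).
    + apply meet_at_ends_flip_l, meet_at_ends_flip_r; exact (Hmeet _ _ He Hf N4).
Qed.

(** * Necklaces of pieces *)

Local Open Scope nat_scope.

(* A piece lies between two legs. The leg at [p] with heading [r] is the pair of vertices [p] and
   [p + zeta^r (zeta^2 + zeta^3)], which is not an edge. The four ends of the legs have degree 2
   in the piece and all other vertices have degree 4, so pieces strung along common legs into
   a closed necklace give a 4-regular graph. As all degrees are even, a piece is recorded by
   an Euler circuit from [p] for the heading [r = 0]: the directions of its successive steps. *)
Inductive piece := Turn | Back | Step | HalfDisk | Lobe.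

Definition circuit (x : piece) : list nat :=
  match x with
  | Turn => [2; 0; 10; 6; 2; 3; 6; 9; 10; 6]
  | Back => [11; 2; 1; 5; 9; 5; 1; 5; 9; 8]
  | Step => [2; 1; 0; 8; 9; 5; 1; 4; 5; 9; 10; 6]
  (* Six [Turn]s, half of the ring around its centre C, in which four inner edges [ab] are
     replaced by paths [a m b] with [abm] equilateral; each [m] is then joined to C and to one
     other [m]. This adds the 5 vertices C, m, ..., m and gives access to odd orders. *)
  | HalfDisk =>
      [2; 0; 10; 3; 1; 11; 4; 2; 0; 5; 3; 1; 6; 4; 2; 7; 5; 3; 11; 7; 8; 9; 10; 6; 2; 1;
       2; 3; 11; 10; 6; 7; 10; 7; 11; 6; 7; 3; 11; 10; 11; 0; 2; 3; 3; 4; 8; 7; 0; 11;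
       7; 6; 11; 10; 8; 7; 3; 4; 7; 4; 8; 9; 10; 0; 1; 5; 4; 9; 8; 6]
  (* [Back Turn^7 Back] with 7 vertices added inside in the same spirit. *)
  | Lobe =>
      [11; 1; 11; 9; 2; 0; 10; 3; 1; 11; 4; 2; 0; 5; 3; 1; 6; 4; 2; 7; 5; 3; 5; 8; 7;
       11; 9; 10; 11; 11; 0; 1; 3; 4; 4; 5; 5; 8; 5; 9; 1; 9; 7; 8; 0; 8; 11; 11; 2; 11;
       10; 2; 3; 5; 6; 4; 5; 2; 1; 9; 8; 1; 0; 8; 7; 7; 8; 9; 10; 11; 1; 2; 6; 5; 10; 9;
       7; 6; 2; 3; 6; 9; 10; 6; 5; 1; 2; 5; 3; 0; 4; 8; 7; 9; 1; 8; 9; 5; 2; 5; 1; 5; 9;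
       8]
  end.

(** For the heading 0, these directions sum to the displacement from [p] to the base vertex of the
    next leg. *)
Definition exit_path (x : piece) : list nat :=
  match x with
  | Turn => [0; 0]
  | Back => [11]
  | Step => [0; 11]
  | HalfDisk => [2; 2; 2; 2; 3; 3; 3; 3]
  | Lobe => [1; 1; 2; 2; 2; 2; 3; 3]
  end.

(** Change of heading in units of 30 degrees mod 12; 11 stands for -1. *)
Definition turning (x : piece) : nat :=
  match x with Turn => 1 | Back => 11 | Step => 0 | HalfDisk => 6 | Lobe => 5 end.

Fixpoint walk (p : pt) (ds : list nat) : list edge :=
  match ds with
  | [] => []
  | d :: ds' => let q := add p (dir d) in (p, q) :: walk q ds'
  end.

(** Nothing here forces the necklace to close up; [check] tests this through the degrees. *)
Fixpoint necklace (p : pt) (r : nat) (w : list piece) : list edge :=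
  match w with
  | [] => []
  | x :: w' =>
      let turned := map (fun d => (d + r) mod 12) in
      walk p (turned (circuit x)) ++
      necklace (fold_left (fun q d => add q (dir d)) (turned (exit_path x)) p)
               ((r + turning x) mod 12) w'
  end.

(* For the residue [i] of [n] mod 12, [(b, (u, v, w))] stands for the necklaces
   [u Step^h v Step^h w] of order [n = b + 12 h]. [v] turns by 180 degrees in total, so the two
   runs of the translation [Step] cancel and the necklace stays closed. *)
Definition family (i : nat) : nat * (list piece * list piece * list piece) :=
  let t := repeat Turn in
  match i with
  | 0 => (60, ([], t 6, t 6))
  | 1 => (85, ([Turn; Back], [HalfDisk; Turn; Back], t 6))
  | 2 => (98, ([], t 6, [Turn; Step; Step; Step] ++ t 7 ++ [Back; Back]))
  | 3 => (87, ([Lobe; Turn], t 6, []))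
  | 4 => (100, ([Turn; Back; Turn; Back], t 7 ++ [Back; Turn; Back], t 6))
  | 5 => (65, ([], [HalfDisk], t 6))
  | 6 => (90, ([Turn; Back], [HalfDisk; Turn; Back], [HalfDisk]))
  | 7 => (103, ([], [HalfDisk], [Turn; Step; Step; Step] ++ t 7 ++ [Back; Back]))
  | 8 => (80, ([Turn; Back], t 7 ++ [Back], t 6))
  | 9 => (105, ([Turn; Back; Turn; Back], [HalfDisk; Turn; Back; Turn; Back], t 6))
  | 10 => (70, ([], [HalfDisk], [HalfDisk]))
  | _ => (107, ([Lobe; Turn], [Back] ++ t 7 ++ [Back; Turn], []))
  end.

(** Each [Step] adds 6 vertices and occurs in two runs, hence the division by 12. For n = 60 and n
    >= 97 the subtraction is exact, since b <= n. *)
Definition graph (n : nat) : list edge :=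
  let '(b, (u, v, w)) := family (n mod 12) in
  let s := repeat Step ((n - b) / 12) in
  necklace (Pt 0 0 0 0) 0 (u ++ s ++ v ++ s ++ w).

Lemma graphs_ok : forallb (fun n => check n (graph n)) (60 :: seq 97 60) = true.
Proof. vm_compute. reflexivity. Qed.

Local Close Scope nat_scope.

(** * Disjoint unions *)

Lemma fst_bounded (n : nat) (pos : nat -> point) :
  exists M, forall i, (i < n)%nat -> - M <= fst (pos i) <= M.
Proof.
  induction n as [|n [M HM]]; [exists 0; lia|].
  exists (Rmax M (Rabs (fst (pos n)))). intros i Hi.
  pose proof (Rmax_l M (Rabs (fst (pos n)))). pose proof (Rmax_r M (Rabs (fst (pos n)))).
  destruct (Nat.eq_dec i n) as [->|].
  - pose proof (Rle_abs (fst (pos n))). pose proof (Rle_abs (- fst (pos n))).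
    rewrite Rabs_Ropp in *. lra.
  - specialize (HM i ltac:(lia)). lra.
Qed.

Lemma on_segment_fst_between (P Q X : point) (l u : R) :
  l <= fst P <= u -> l <= fst Q <= u -> on_segment P Q X -> l <= fst X <= u.
Proof. intros HP HQ [t [Ht ->]]; simpl; split; nra. Qed.

Lemma on_segment_translate (T : R) (P Q X : point) :
  on_segment (fst P + T, snd P) (fst Q + T, snd Q) X -> on_segment P Q (fst X - T, snd X).
Proof. intros [t [Ht ->]]; exists t; split; [assumption|]; simpl; f_equal; ring. Qed.

Lemma length_filter_false (f : nat -> bool) (l : list nat) :
  (forall j, In j l -> f j = false) -> length (filter f l) = 0%nat.
Proof.
  intros H; induction l as [|x l IH]; simpl; [reflexivity|].
  rewrite (H x) by (simpl; auto). apply IH; intros; apply H; simpl; auto.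
Qed.

Lemma length_filter_shift (f : nat -> bool) (m n : nat) :
  length (filter f (seq m n)) = length (filter (fun j => f (m + j)%nat) (seq 0 n)).
Proof.
  revert m; induction n as [|n IH]; intros m; [reflexivity|].
  rewrite !seq_S, !filter_app, !length_app, IH; simpl. destruct (f (m + n)%nat); reflexivity.
Qed.

Lemma four_regular_disjoint_union (m n : nat) :
  four_regular_matchstick_graph m -> four_regular_matchstick_graph n ->
  four_regular_matchstick_graph (m + n).
Proof.
  intros (adj1 & pos1 & [irr1 sym1 sup1] & deg1 & inj1 & len1 & meet1)
         (adj2 & pos2 & [irr2 sym2 sup2] & deg2 & inj2 & len2 & meet2).
  destruct (fst_bounded m pos1) as [M1 HM1]. destruct (fst_bounded n pos2) as [M2 HM2].
  (* The first drawing lies in x <= M1; shifted by T, the second lies in x >= M1 + 1, so no edge of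
     one meets an edge of the other. *)
  set (T := M1 + M2 + 1).
  set (adj := fun i j => if (i <? m)%nat then (if (j <? m)%nat then adj1 i j else false)
                         else if (j <? m)%nat then false else adj2 (i - m)%nat (j - m)%nat).
  set (pos := fun i => if (i <? m)%nat then pos1 i
                       else (fst (pos2 (i - m)%nat) + T, snd (pos2 (i - m)%nat))).
  assert (Hadj : forall i j, adj i j = true ->
    ((i < m)%nat /\ (j < m)%nat /\ adj1 i j = true) \/
    ((m <= i)%nat /\ (m <= j)%nat /\ adj2 (i - m)%nat (j - m)%nat = true)).
  { intros i j; unfold adj.
    destruct (Nat.ltb_spec i m), (Nat.ltb_spec j m); intuition congruence. }
  assert (P1 : forall i, (i < m)%nat -> pos i = pos1 i).
  { intros i Hi; unfold pos; now rewrite (proj2 (Nat.ltb_lt i m) Hi). }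
  assert (P2 : forall i, (m <= i)%nat ->
    pos i = (fst (pos2 (i - m)%nat) + T, snd (pos2 (i - m)%nat))).
  { intros i Hi; unfold pos; now rewrite (proj2 (Nat.ltb_ge i m) Hi). }
  assert (Left : forall a b X, (a < m)%nat -> (b < m)%nat ->
    on_segment (pos a) (pos b) X -> fst X <= M1).
  { intros a b X Ha Hb HX; rewrite !P1 in HX by assumption.
    eapply on_segment_fst_between in HX; [apply HX| |]; apply HM1; assumption. }
  assert (Right : forall a b X, (m <= a < m + n)%nat -> (m <= b < m + n)%nat ->
    on_segment (pos a) (pos b) X -> M1 < fst X).
  { intros a b X Ha Hb HX; rewrite !P2 in HX by lia.
    apply on_segment_translate in HX.
    eapply on_segment_fst_between in HX; [|apply HM2; lia|apply HM2; lia].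
    simpl in HX; unfold T in HX; lra. }
  exists adj, pos; split; [split|split; [|split; [|split]]].
  - intros i; unfold adj; destruct (i <? m)%nat; auto.
  - intros i j; unfold adj; destruct (i <? m)%nat, (j <? m)%nat; auto.
  - intros i j H; destruct (Hadj i j H) as [(? & ? & _)|(? & ? & E)]; [lia|].
    apply sup2 in E; lia.
  - intros i Hi; unfold degree; rewrite seq_app, filter_app, length_app, Nat.add_0_l.
    rewrite (length_filter_shift _ m n). destruct (Nat.ltb_spec i m) as [Him|Him].
    + rewrite (length_filter_false _ (seq 0 n)).
      * rewrite Nat.add_0_r, <- (deg1 i Him); unfold degree; f_equal.
        apply filter_ext_in; intros j Hj; apply in_seq in Hj; unfold adj.
        rewrite (proj2 (Nat.ltb_lt i m)), (proj2 (Nat.ltb_lt j m)) by lia; reflexivity.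
      * intros j _; unfold adj.
        rewrite (proj2 (Nat.ltb_lt i m)), (proj2 (Nat.ltb_ge (m + j) m)) by lia; reflexivity.
    + rewrite (length_filter_false _ (seq 0 m)).
      * rewrite Nat.add_0_l, <- (deg2 (i - m)%nat ltac:(lia)); unfold degree; f_equal.
        apply filter_ext; intros j; unfold adj.
        rewrite (proj2 (Nat.ltb_ge i m)), (proj2 (Nat.ltb_ge (m + j) m)) by lia.
        f_equal; lia.
      * intros j Hj; apply in_seq in Hj; unfold adj.
        rewrite (proj2 (Nat.ltb_ge i m)), (proj2 (Nat.ltb_lt j m)) by lia; reflexivity.
  - assert (Hlr : forall i j, (i < m)%nat -> (m <= j < m + n)%nat -> pos i <> pos j).
    { intros i j Hi Hj E; rewrite P1, P2 in E by lia.
      apply (f_equal fst) in E; simpl in E.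
      specialize (HM1 i Hi); specialize (HM2 (j - m)%nat ltac:(lia)); unfold T in E; lra. }
    intros i j Hi Hj E.
    destruct (Nat.lt_ge_cases i m), (Nat.lt_ge_cases j m).
    + rewrite !P1 in E by assumption; auto.
    + destruct (Hlr i j); auto.
    + destruct (Hlr j i); auto.
    + rewrite !P2 in E by assumption; injection E as E1 E2.
      assert (i - m = j - m)%nat; [|lia].
      apply inj2; [lia|lia|].
      apply injective_projections; [lra|assumption].
  - intros i j H; destruct (Hadj i j H) as [(Hi & Hj & E)|(Hi & Hj & E)].
    + rewrite !P1 by assumption; auto.
    + rewrite !P2 by assumption; rewrite <- (len2 _ _ E); unfold dist2; simpl; ring.
  - intros a b c d Hab Hcd Hne X HX HX'.
    destruct (Hadj a b Hab) as [(Ha & Hb & E)|(Ha & Hb & E)];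
      destruct (Hadj c d Hcd) as [(Hc & Hd & F)|(Hc & Hd & F)].
    + rewrite !P1 in * by assumption; eapply meet1; eauto.
    + apply sup2 in F. pose proof (Left a b X Ha Hb HX).
      pose proof (Right c d X ltac:(lia) ltac:(lia) HX'). lra.
    + apply sup2 in E. pose proof (Left c d X Hc Hd HX').
      pose proof (Right a b X ltac:(lia) ltac:(lia) HX). lra.
    + rewrite !P2 in * by assumption.
      apply on_segment_translate in HX, HX'.
      assert (Hne' : ~ ((a - m = c - m /\ b - m = d - m) \/ (a - m = d - m /\ b - m = c - m))%nat)
        by lia.
      destruct (meet2 _ _ _ _ E F Hne' _ HX HX') as [HA HB].
      assert (back : forall P : point, (fst X - T, snd X) = P -> X = (fst P + T, snd P)).
      { intros P <-; destruct X; simpl; f_equal; ring. }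
      split; [destruct HA as [HA|HA]|destruct HB as [HB|HB]]; auto.
Qed.

(** * Induction on the order in steps of 60 *)

Theorem theorem5p2 : forall n : nat, (97 <= n)%nat -> four_regular_matchstick_graph n.
Proof.
  pose proof graphs_ok as Hok. rewrite forallb_forall in Hok.
  induction n as [n IH] using lt_wf_ind; intros Hn.
  (* 157 = 97 + 60, so from here on n - 60 is still at least 97. *)
  destruct (Nat.lt_ge_cases n 157).
  - apply (check_sound n (graph n)), Hok; right; apply in_seq; lia.
  - replace n with (60 + (n - 60))%nat by lia.
    apply four_regular_disjoint_union.
    + apply (check_sound 60 (graph 60)), Hok; left; reflexivity.
    + apply IH; lia.
Qed.
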